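(* Let $F$ be a 2-CNF formula, $L$ a set of literals such that $SWRT(F,\neg L)$ is true, and $l_y$ a literal with $Var(l_y)\notin Var(L)$. Let $D$ be the implication graph of $F$. Then: (1) the largest number $MaxPaths(F,L,l_y)$ of pairwise clause-disjoint paths of $F$ from $L$ to $l_y$ equals the largest number of pairwise arc-disjoint paths of $D$ from $\neg L$ to $l_y$; (2) $SepSize(F,L,l_y)=ArcSepSize(D,\neg L,l_y)$; (3) $MaxPaths(F,L,l_y)=SepSize(F,L,l_y)$.
   Context: A literal is a Boolean variable or its negation; $\neg$ denotes negation, and for a set $L$ of literals $\neg L=\{\neg l': l'\in L\}$. $Var(\cdot)$ denotes the set of variables. A 2-CNF formula $F$ is a conjunction of clauses each consisting of exactly two literals (a one-literal clause $(l)$ is written $(l\vee l)$; $(l_1\vee l_2)$ and $(l_2\vee l_1)$ are the same clause), with pairwise distinct clauses; $F\setminus S$ denotes the formula of clauses of $F$ not in the set $S$. A set of literals is non-contradictory if it contains no literal and its negation. A satisfying assignment of $F$ is a non-contradictory set $P$ of literals with $Var(P)=Var(F)$ such that each clause of $F$ contains a literal of $P$. $SWRT(F,M)$ means $F$ has a satisfying assignment $P$ with $P\cap \neg M=\emptyset$. A walk of $F$ is a nonempty sequence $(C_1,\dots,C_q)$ of (not necessarily distinct) clauses of $F$ where in each entry one literal is designated first and the other second, such that for $i<q$ the second literal of $C_i$ is the negation of the first literal of $C_{i+1}$; it is from the first literal of $C_1$ to the second literal of $C_q$, and from a set $M$ if its first literal lies in $M$. A path of $F$ is a walk whose clauses are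 pairwise distinct; paths are clause-disjoint if no clause occurs in two of them. A separator of $F$ w.r.t. a set of literals $M$ and literal $l_y$ is a set $SC$ of clauses of $F$ such that $F\setminus SC$ has no path from $M$ to $l_y$; $SepSize(F,M,l_y)$ is its minimum size. The implication graph $D$ of $F$ is the digraph whose vertices are the literals of the variables of $F$, with an arc $(l_1,l_2)$ iff $(\neg l_1\vee l_2)$ is a clause of $F$. Paths in $D$ are directed paths (no repeated vertices) with at least one arc, and a path from a vertex set $M$ starts at a vertex of $M$. An arc separator of $D$ w.r.t. $M$ and $l_y$ is a set of arcs whose removal leaves no path from $M$ to $l_y$; $ArcSepSize(D,M,l_y)$ is its minimum size. *)

(* Defs.v *)
From HB Require Import structures.
From mathcomp Require Import all_boot.
From mathcomp Require Import boolp.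

Set Implicit Arguments.
Unset Strict Implicit.
Unset Printing Implicit Defensive.

(* (x, true) is the positive literal of the variable x, (x, false) its
   negation. *)
Definition lit (V : finType) : Type := (V * bool)%type.
HB.instance Definition _ (V : finType) := Finite.copy (lit V) (V * bool)%type.

Definition pairwise_disjoint (X : eqType) (ss : seq (seq X)) : bool :=
  pairwise (fun s t => ~~ has (mem s) t) ss.

Lemma pairwise_disjoint_size (X : finType) (A : {set X}) (ss : seq (seq X)) :
    (forall s, s \in ss -> s != [::] /\ {subset s <= A}) ->
  pairwise_disjoint ss -> size ss <= #|A|.
Proof.
move=> ssA dss.
have [hd [hds hdu hdss]] : exists hd : seq X, [/\ size hd = size ss, uniq hd
    & forall x, x \in hd -> exists2 s, s \in ss & x \in s].
  elim: ss ssA dss => [|s ss IH] ssA /=; first by exists [::].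
  rewrite /pairwise_disjoint /= => /andP[/allP ds dss].
  have [t tss|hd [hds hdu hdss]] := IH _ dss.
    by apply: ssA; rewrite inE tss orbT.
  have [s0 _] := ssA s (mem_head _ _).
  case: s s0 ds {ssA} => // x s _ ds.
  exists (x :: hd); split => /=; first by rewrite hds.
    rewrite hdu andbT; apply/negP => /hdss[t tss xt].
    by move/hasP: (ds _ tss); apply; exists x => //; rewrite /= inE eqxx.
  move=> y; rewrite inE => /predU1P[->|/hdss[t tss yt]].
    by exists (x :: s); rewrite ?mem_head.
  by exists t => //; rewrite inE tss orbT.
rewrite -hds -(card_uniqP hdu); apply/subset_leq_card/subsetP => x.
by case/hdss => s /ssA[_ sA] /sA.
Qed.

Section TwoCNF.
Variable V : finType.
Implicit Types (l : lit V) (L M P : {set lit V}) (F SC : {set {set lit V}}).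

Definition var l : V := l.1.
Definition neg l : lit V := (l.1, ~~ l.2).
Definition negs L : {set lit V} := [set neg l | l in L].
Definition lit_vars L : {set V} := [set var l | l in L].
Definition cnf_vars F : {set V} := lit_vars (cover F).

(* (l1 \/ l2) is the unordered pair [set l1; l2]; the one-literal clause
   (l \/ l) is the singleton [set l; l] = [set l]. *)
Definition is_2cnf F : Prop :=
  forall C, C \in F -> exists l1 l2, C = [set l1; l2].

Definition noncontradictory P : Prop := forall l, l \in P -> neg l \notin P.

Definition satisfying F P : Prop :=
  [/\ noncontradictory P, lit_vars P = cnf_vars F
    & forall C, C \in F -> exists2 l, l \in C & l \in P].

Definition SWRT F M : Prop :=
  exists2 P, satisfying F P & P :&: negs M = set0.

(* An entry of a walk is the pair (first literal, second literal). *)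
Definition entry : Type := (lit V * lit V)%type.
Definition entry_clause (e : entry) : {set lit V} := [set e.1; e.2].
Definition walk_clauses (w : seq entry) : seq {set lit V} :=
  map entry_clause w.

Definition is_walk F (w : seq entry) : bool :=
  [&& w != [::], all (fun e => entry_clause e \in F) w
    & sorted (fun e e' => e.2 == neg e'.1) w].

Definition is_path F (w : seq entry) : bool :=
  is_walk F w && uniq (walk_clauses w).

Definition walk_from_to M l (w : seq entry) : bool :=
  if w is e :: w' then (e.1 \in M) && ((last e w').2 == l) else false.

Definition clause_disjoint_paths F M l (n : nat) : Prop :=
  exists ps : seq (seq entry),
    [/\ size ps = n,
        forall w, w \in ps -> is_path F w && walk_from_to M l w
      & pairwise_disjoint (map walk_clauses ps)].

Definition is_separator F M l SC : Prop :=
  SC \subset F /\ ~ exists w, is_path (F :\: SC) w && walk_from_to M l w.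

Definition separator_of_size F M l (n : nat) : Prop :=
  exists2 SC, is_separator F M l SC & #|SC| = n.

Lemma clause_disjoint_paths_ex F M l :
  exists n, `[< clause_disjoint_paths F M l n >].
Proof. by exists 0; apply/asboolP; exists [::]; split. Qed.

Lemma clause_disjoint_paths_ub F M l n :
  `[< clause_disjoint_paths F M l n >] -> n <= #|F|.
Proof.
move=> /asboolP[ps [<- psF dps]]; rewrite -(size_map walk_clauses).
apply: pairwise_disjoint_size dps => _ /mapP[w /psF wF ->].
move: wF => /andP[/andP[/and3P[w0 /allP wF _] _] _]; split; first by case: w w0 wF.
by move=> _ /mapP[e /wF eF ->].
Qed.

Lemma separator_of_size_ex F M l : exists n, `[< separator_of_size F M l n >].
Proof.
exists #|F|; apply/asboolP; exists F => //; split => //.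
move=> [[|e w] /andP[/andP[/and3P[//= _ /andP[]]]]].
by rewrite setDv inE.
Qed.

Definition MaxPaths F M l : nat :=
  ex_maxn (clause_disjoint_paths_ex F M l) (@clause_disjoint_paths_ub F M l).

Definition SepSize F M l : nat := ex_minn (separator_of_size_ex F M l).

End TwoCNF.

Record digraph (T : finType) := Digraph {
  vertices : {set T};
  arcs : {set T * T}
}.

Section Digraph.
Variable T : finType.
Implicit Types (D : digraph T) (M : {set T}) (S : {set T * T}) (y : T).

Definition remove_arcs D S : digraph T := Digraph (vertices D) (arcs D :\: S).

(* A directed path is given by the sequence of its vertices. *)
Definition is_dpath D (p : seq T) : bool :=
  [&& 1 < size p, uniq p, all (mem (vertices D)) p
    & sorted (fun x y => (x, y) \in arcs D) p].

Definition dpath_arcs (p : seq T) : seq (T * T) := zip p (behead p).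

Definition dpath_from_to M y (p : seq T) : bool :=
  if p is x :: p' then (x \in M) && (last x p' == y) else false.

Definition arc_disjoint_paths D M y (n : nat) : Prop :=
  exists ps : seq (seq T),
    [/\ size ps = n,
        forall p, p \in ps -> is_dpath D p && dpath_from_to M y p
      & pairwise_disjoint (map dpath_arcs ps)].

Definition is_arc_separator D M y S : Prop :=
  S \subset arcs D /\
  ~ exists p, is_dpath (remove_arcs D S) p && dpath_from_to M y p.

Definition arc_separator_of_size D M y (n : nat) : Prop :=
  exists2 S, is_arc_separator D M y S & #|S| = n.

Lemma arc_disjoint_paths_ex D M y :
  exists n, `[< arc_disjoint_paths D M y n >].
Proof. by exists 0; apply/asboolP; exists [::]; split. Qed.

Lemma arc_disjoint_paths_ub D M y n :
  `[< arc_disjoint_paths D M y n >] -> n <= #|arcs D|.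
Proof.
move=> /asboolP[ps [<- psD dps]]; rewrite -(size_map dpath_arcs).
apply: pairwise_disjoint_size dps => _ /mapP[p /psD pD ->].
move: pD => /andP[/and4P[p2 _ _ pD] _].
case: p p2 pD => [//|x [//|x' p]] _ pD; split => // a.
rewrite /dpath_arcs /=; elim: p x x' pD => [|z p IH] x x' /=.
  by rewrite andbT inE => xx' /eqP->.
by move=> /andP[xx' x'p]; rewrite inE => /predU1P[->//|]; apply: IH.
Qed.

Lemma arc_separator_of_size_ex D M y :
  exists n, `[< arc_separator_of_size D M y n >].
Proof.
exists #|arcs D|; apply/asboolP; exists (arcs D) => //; split => //.
move=> [[|x [|x' p]] /andP[/and4P[//= _ _ _ /andP[]]]].
by rewrite setDv inE.
Qed.

Definition MaxArcPaths D M y : nat :=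
  ex_maxn (arc_disjoint_paths_ex D M y) (@arc_disjoint_paths_ub D M y).

Definition ArcSepSize D M y : nat := ex_minn (arc_separator_of_size_ex D M y).

End Digraph.

Definition implication_graph (V : finType) (F : {set {set lit V}}) :
    digraph (lit V) :=
  Digraph [set l : lit V | var l \in cnf_vars F]
          [set a : lit V * lit V | [set neg a.1; a.2] \in F].

(* Main.v *)
Require Import Defs.
From mathcomp Require Import all_boot all_order all_algebra.
From mathcomp Require Import boolp zify.

Set Implicit Arguments.
Unset Strict Implicit.
Unset Printing Implicit Defensive.

Import GRing.Theory Num.Theory.

(** Fix an assignment [P] satisfying [F] and avoiding [L].  Along a walk of [F]
    from [L] every first literal is false and every second literal is true
    under [P], so each arc of the implication graph that can be used from
    [negs L] joins two literals of [P] and is determined by its clause.  Hence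
    all four quantities are squeezed by
    [ArcSepSize <= MaxArcPaths <= MaxPaths <= SepSize <= ArcSepSize]:
    the first inequality is the arc version of Menger's theorem, the second
    turns arc-disjoint paths into clause-disjoint ones, the third is weak
    duality, and the last one shortens a walk of [F] to a path avoiding
    repeated literals.  Menger's theorem is proved by augmenting 0/1 flows
    along residual paths. *)

(** * Arcs of a vertex sequence *)

Section Arcs.
Variable T : finType.
Implicit Types (x y u v : T) (p : seq T).

Lemma path_dpath_arcs (pT : predType (T * T)) (S : pT) x p :
  path (fun u v => (u, v) \in S) x p = all (mem S) (dpath_arcs (x :: p)).
Proof. by elim: p x => //= z p IH x; rewrite IH. Qed.

Lemma dpath_arcs_fst x p a : a \in dpath_arcs (x :: p) -> a.1 \in x :: p.
Proof.
elim: p x => //= z p IH x; rewrite inE => /predU1P[->|/IH]; first exact: mem_head.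
by rewrite [a.1 \in x :: _]inE => ->; rewrite orbT.
Qed.

Lemma dpath_arcs_uniq p : uniq p -> uniq (dpath_arcs p).
Proof. exact: zip_uniql. Qed.

End Arcs.

(** * 0/1 flows: augmentation, cuts, decomposition into paths *)

Section Menger.
Local Open Scope ring_scope.
Variable T : finType.
Implicit Types (x y u v : T) (p : seq T) (M X : {set T}) (A f : {set T * T}).

(* A set of arcs is regarded as a 0/1 flow. *)
Definition excess f v : int := \sum_(a in f) ((a.1 == v)%:Z - (a.2 == v)%:Z).

Lemma excessU1 f a v : a \notin f ->
  excess (a |: f) v = (a.1 == v)%:Z - (a.2 == v)%:Z + excess f v.
Proof. by move=> af; rewrite /excess big_setU1. Qed.

Lemma excessD1 f a v : a \in f ->
  excess f v = (a.1 == v)%:Z - (a.2 == v)%:Z + excess (f :\ a) v.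
Proof. by move=> af; rewrite /excess (big_setD1 _ af). Qed.

Lemma excess_sum f X :
  \sum_(v in X) excess f v = \sum_(a in f) ((a.1 \in X)%:Z - (a.2 \in X)%:Z).
Proof.
rewrite exchange_big; apply: eq_bigr => a _ /=; rewrite sumrB.
have count x : \sum_(v in X) (x == v)%:Z = (x \in X)%:Z.
  case: (boolP (x \in X)) => xX.
    rewrite (bigD1 x) //= eqxx big1 ?addr0 // => v /andP[_ /negPf].
    by rewrite eq_sym => ->.
  by rewrite big1 // => v vX; case: eqP => // xv; rewrite xv vX in xX.
by rewrite !count.
Qed.

Definition residual A f u v := ((u, v) \in A :\: f) || ((v, u) \in f).

Lemma augment A f u p : f \subset A -> path (residual A f) u p ->
    uniq (u :: p) ->
  exists2 f' : {set T * T}, f' \subset A &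
    forall v, excess f' v = excess f v + (u == v)%:Z - (last u p == v)%:Z.
Proof.
elim: p u f => [|w q IH] u f fA /=.
  by exists f => // v; rewrite addrK.
move=> /andP[uw wq] /andP[u_wq wq_uniq].
(* Only an arc at [u] is toggled, and the rest of the path avoids [u], so it stays residual for
   [f1]. *)
have [f1 [f1A f1E f1res]] : exists f1 : {set T * T}, [/\ f1 \subset A,
    forall v, excess f1 v = excess f v + (u == v)%:Z - (w == v)%:Z
  & forall s t, s != u -> t != u -> residual A f s t -> residual A f1 s t].
  case/orP: uw => [|wuf].
    rewrite inE => /andP[uwf uwA]; exists ((u, w) |: f); split.
    - by rewrite subUset sub1set uwA.
    - by move=> v; rewrite excessU1 //=; lia.
    - move=> s t /negPf su /negPf tu.
      by rewrite /residual !inE !xpair_eqE su tu /= ?andbF.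
  exists (f :\ (w, u)); split.
  - exact: subset_trans (subsetDl _ _) fA.
  - by move=> v; rewrite (excessD1 v wuf) /=; move: (excess _ v) => e; lia.
  - move=> s t /negPf su /negPf tu.
    by rewrite /residual !inE !xpair_eqE su tu /= ?andbF.
have wq1 : path (residual A f1) w q.
  apply: (@sub_in_path _ (fun v => v != u) (residual A f)) wq.
    by move=> s t; apply: f1res.
  by apply/allP => z zq /=; apply: contraNneq u_wq => <-.
have [f' f'A f'E] := IH w f1 f1A wq1 wq_uniq.
by exists f' => // v; rewrite f'E f1E; lia.
Qed.

(** Excess is outflow minus inflow, hence the negative sign at the sink [y]; the sources [M] are
    left unconstrained. *)
Definition is_flow M y f (n : nat) : Prop :=
  excess f y = - n%:Z /\ forall v, v \notin M -> v != y -> excess f v = 0.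

Lemma flow_excess_cut M y f n X : is_flow M y f n ->
    y \in X -> [disjoint M & X] ->
  \sum_(a in f) ((a.1 \in X)%:Z - (a.2 \in X)%:Z) = - n%:Z.
Proof.
move=> [fy fv] yX dMX; rewrite -excess_sum (bigD1 y) //= fy big1 ?addr0 //.
move=> v /andP[vX vy]; apply: fv => //.
by apply/negP => vM; rewrite (disjointFr dMX vM) in vX.
Qed.

Definition reached (e : rel T) M : {set T} :=
  [set v | [exists x in M, connect e x v]].

Lemma reached_step e M u v : u \in reached e M -> e u v -> v \in reached e M.
Proof.
rewrite !inE => /existsP[x /andP[xM xu]] uv.
by apply/existsP; exists x; rewrite xM (connect_trans xu (connect1 uv)).
Qed.

Lemma reached_src e M : M \subset reached e M.
Proof.
by apply/subsetP => x xM; rewrite inE; apply/existsP; exists x; rewrite xM connect0.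
Qed.

Lemma reached_path e M y : y \in reached e M ->
  exists x p, [/\ x \in M, path e x p, last x p = y & uniq (x :: p)].
Proof.
rewrite inE => /existsP[x /andP[xM /connectP[p xp ->]]].
by case: (shortenP xp) => p' xp' p'u _; exists x, p'.
Qed.

(** Max-flow min-cut by induction on [n]: augment if [y] is residually reachable from [M]; otherwise
    the unreached vertices give a cut of exactly [n] arcs. *)
Lemma flow_or_cut A M y n : y \notin M ->
  (exists2 f : {set T * T}, f \subset A & is_flow M y f n) \/
  (exists X, [/\ y \in X, [disjoint M & X]
     & #|[set a in A | (a.1 \notin X) && (a.2 \in X)]| < n]%N).
Proof.
move=> yM; elim: n => [|n [[f fA fn]|[X [yX dMX cutX]]]].
- left; exists set0; first exact: sub0set.
  by split=> [|v _ _]; rewrite /excess big_set0.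
- have [yR|yR] := boolP (y \in reached (residual A f) M).
    left; have [x [p [xM xp lastp xp_uniq]]] := reached_path yR.
    have [f' f'A f'E] := augment fA xp xp_uniq.
    have [fy fv] := fn; exists f' => //; split.
      rewrite f'E lastp fy eqxx; case: eqP => [xy|_]; last by lia.
      by rewrite -xy xM in yM.
    move=> v vM vy; rewrite f'E lastp fv // [y == v]eq_sym (negPf vy).
    by case: eqP => // xv; rewrite -xv xM in vM.
  right; have := reached_src (residual A f) M.
  move: (reached _ _) (@reached_step (residual A f) M) yR => R stepR yR srcR.
  have yR' : y \in ~: R by rewrite inE.
  have dR : [disjoint M & ~: R].
    by rewrite -setI_eq0 -subset0 -setDE subDset setU0.
  exists (~: R); split=> //.
  have := flow_excess_cut fn yR' dR; set S := [set a in A | _].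
  have Sf : S \subset f.
    apply/subsetP => -[u v]; rewrite !inE /= negbK => /and3P[uvA uR].
    apply: contraNT => uvf; apply: stepR uR _.
    by rewrite /residual inE uvf uvA.
  (* Arcs of [S] contribute -1 each. Other arcs of [f] contribute 0: one with head in [R] has its
     tail in [R] too, through the reversed residual arc. *)
  rewrite (big_setID S) /= (setIidPr Sf) [X in _ + X]big1 => [|[u v]].
    rewrite addr0 (eq_bigr (fun=> -1)) => [|a].
      by rewrite sumr_const mulNrn natz => /oppr_inj[->].
    by rewrite !inE negbK => /and3P[_ -> /negbTE->].
  rewrite !inE /= => /andP[uvS uvf]; have uvA := subsetP fA _ uvf.
  move: uvS; rewrite uvA /= negbK.
  have [vR|vR] /= := boolP (v \in R); last by rewrite andbT => /negbTE->.
  suff -> : u \in R by [].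
  by apply: stepR vR _; rewrite /residual uvf orbT.
- by right; exists X; split=> //; apply: ltnW.
Qed.

Lemma excess_remove_path f u p : uniq (u :: p) ->
    {subset dpath_arcs (u :: p) <= f} ->
  forall v, excess (f :\: [set a in dpath_arcs (u :: p)]) v
    = excess f v - (u == v)%:Z + (last u p == v)%:Z.
Proof.
elim: p u f => [|w q IH] u f /=.
  move=> _ _ v; rewrite subrK; congr excess.
  by apply/setP => a; rewrite !inE.
move=> /andP[u_wq wq_uniq] sub v.
have uwf : (u, w) \in f by apply: sub; rewrite mem_head.
have sub1 : {subset dpath_arcs (w :: q) <= f :\ (u, w)}.
  move=> a aq; rewrite in_setD1; apply/andP; split; last first.
    by apply: sub; rewrite inE aq orbT.
  by apply: contraNneq u_wq => au; have := dpath_arcs_fst aq; rewrite au.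
have -> : f :\: [set a in dpath_arcs [:: u, w & q]] =
    (f :\ (u, w)) :\: [set a in dpath_arcs (w :: q)].
  by apply/setP => a; rewrite !inE negb_or; case: (a == _); rewrite ?andbF.
by rewrite IH // (excessD1 v uwf) /=; move: (excess _ v) => e; lia.
Qed.

(** A flow of positive value contains a path from [M] to [y]; deleting its arcs lowers the value by
    one, and later paths use only the remaining arcs. *)
Lemma flow_decomposition M y f n : y \notin M -> is_flow M y f n ->
  exists ps : seq (seq T), [/\ size ps = n,
    forall p, p \in ps -> [/\ uniq p, dpath_from_to M y p
                            & {subset dpath_arcs p <= f}]
  & pairwise_disjoint (map (@dpath_arcs T) ps)].
Proof.
move=> yM; elim: n f => [|n IH] f fn; first by exists [::].
have [yR|yR] := boolP (y \in reached (fun u v => (u, v) \in f) M); last first.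
  have yR' : y \in ~: reached (fun u v => (u, v) \in f) M by rewrite inE.
  have dR : [disjoint M & ~: reached (fun u v => (u, v) \in f) M].
    by rewrite -setI_eq0 -subset0 -setDE subDset setU0 reached_src.
  have := flow_excess_cut fn yR' dR.
  (* No arc of [f] enters the unreached set, so the sum cannot be [- n.+1]. *)
  suff : 0 <= \sum_(a in f)
      ((a.1 \in ~: reached (fun u v => (u, v) \in f) M)%:Z
     - (a.2 \in ~: reached (fun u v => (u, v) \in f) M)%:Z) by lia.
  apply: sumr_ge0 => -[u v] uvf; rewrite !in_setC /=.
  have := @reached_step (fun u v => (u, v) \in f) M u v.
  by case: (u \in _); case: (v \in _) => // /(_ isT uvf).
have [x [p [xM xp lastp xp_uniq]]] := reached_path yR.
move: xp; rewrite path_dpath_arcs => /allP sub.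
have fE := excess_remove_path xp_uniq sub.
have xy : x != y by apply: contraNneq yM => <-.
have [|ps [szps psf dps]] := IH (f :\: [set a in dpath_arcs (x :: p)]).
  have [fy fv] := fn; split.
    by rewrite fE lastp fy eqxx (negPf xy); lia.
  move=> v vM vy; rewrite fE lastp fv // [y == v]eq_sym (negPf vy).
  by case: eqP => // xv; rewrite -xv xM in vM.
exists ((x :: p) :: ps); split=> /=; first by rewrite szps.
  move=> q; rewrite inE => /predU1P[->|/psf[qu qM qf]].
    by split=> //=; rewrite xM lastp eqxx.
  by split=> // a /qf; rewrite inE => /andP[].
apply/andP; split=> //; apply/allP => _ /mapP[q /psf[_ _ qf] ->].
by apply/hasPn => a /qf; rewrite !inE => /andP[].
Qed.

End Menger.

(** * The arc version of Menger's theorem *)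

Section ArcMenger.
Variables (T : finType) (D : digraph T) (M : {set T}) (y : T).
Hypothesis arcs_vertices :
  forall u v, (u, v) \in arcs D -> (u \in vertices D) && (v \in vertices D).
Hypothesis yM : y \notin M.

Lemma all_arcs_is_dpath p : 1 < size p -> uniq p ->
  {subset dpath_arcs p <= arcs D} -> is_dpath D p.
Proof.
case: p => [//|x [//|x' p]] _ xp_uniq sub; apply/and4P; split=> //.
  elim: p x x' sub {xp_uniq} => [|z p IH] x x' sub; rewrite /= -/(all _ _).
    by have /arcs_vertices/andP[-> ->] : (x, x') \in arcs D by apply/sub/mem_head.
  have /arcs_vertices/andP[-> _] : (x, x') \in arcs D by apply/sub/mem_head.
  by apply: IH => a ap; apply: sub; rewrite inE ap orbT.
by rewrite /= path_dpath_arcs; apply/andP; split;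
  [apply/sub/mem_head | apply/allP => a ap; apply: sub; rewrite inE ap orbT].
Qed.

Lemma ArcSepSize_le_MaxArcPaths : ArcSepSize D M y <= MaxArcPaths D M y.
Proof.
rewrite /ArcSepSize /MaxArcPaths.
case: ex_minnP => n _ n_min; case: ex_maxnP => m _ m_max.
apply: m_max; apply/asboolP.
case: (flow_or_cut (arcs D) n yM) => [[f fA fn]|[X [yX dMX]]]; last first.
  set S := [set a in arcs D | _] => Sn; suff : n <= #|S| by rewrite leqNgt Sn.
  apply: n_min; apply/asboolP; exists S => //; split.
    by apply/subsetP => a; rewrite inE => /andP[].
  move=> [[|x p] /andP[/and4P[_ _ _ xp]] //= /andP[xM /eqP lastp]].
  have : x \notin X by rewrite (disjointFr dMX xM).
  (* A path from outside [X] to [y] in [X] must enter [X], but all entering arcs are removed. *)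
  elim: p x xp lastp {xM} => /= [x _ -> |z p IH x /andP[xz zp] lastp xX].
    by rewrite yX.
  apply: (IH _ zp lastp); move: xz; rewrite !inE /= xX /=.
  by case: (_ \in arcs D); rewrite ?andbF ?andbT.
have [ps [szps psf dps]] := flow_decomposition yM fn.
exists ps; split=> // p /psf[p_uniq pM pf]; rewrite pM andbT.
apply: all_arcs_is_dpath => // [|a /pf /(subsetP fA)//].
case: p pM {p_uniq pf} => [//|x [|//]] /= /andP[xM /eqP xy].
by move: yM; rewrite -xy xM.
Qed.

End ArcMenger.

(** * Walks of a 2-CNF formula and paths of its implication graph *)

Section TwoCNF.
Variables (V : finType) (F : {set {set lit V}}).
Implicit Types (l : lit V) (L P M : {set lit V}) (w : seq (entry V)).

Lemma negK : involutive (@neg V).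
Proof. by case=> x b; rewrite /neg /= negbK. Qed.

(* Disjoint paths contain pairwise distinct elements of any separator. *)
Lemma MaxPaths_le_SepSize L l : MaxPaths F L l <= SepSize F L l.
Proof.
rewrite /MaxPaths /SepSize.
case: ex_maxnP => m /asboolP[ps [<- psF dps]] _.
case: ex_minnP => n /asboolP[SC [SCF nopath] <-] _.
pose trace w := [seq C <- walk_clauses w | C \in SC].
rewrite -(size_map trace); apply: pairwise_disjoint_size.
  move=> _ /mapP[w /psF wF ->]; split; last first.
    by move=> C; rewrite mem_filter => /andP[].
  apply/eqP => w0; apply: nopath; exists w.
  have /andP[/andP[/and3P[wn /allP wFa ws] wu] ->] := wF.
  rewrite andbT /is_path wu andbT; apply/and3P; split=> //.
  apply/allP => e ew /=; rewrite inE (wFa e ew) andbT; apply/negP => eSC.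
  have : entry_clause e \in trace w by rewrite mem_filter eSC map_f.
  by rewrite w0.
move: dps; rewrite /pairwise_disjoint !pairwise_map.
apply: sub_pairwise => w1 w2; apply: contra => /hasP[C] /=.
rewrite !mem_filter => /andP[_ C2] /andP[_ C1].
by apply/hasP; exists C.
Qed.

Definition arc_clause (a : lit V * lit V) : {set lit V} := [set neg a.1; a.2].
Definition arc_entry (a : lit V * lit V) : entry V := (neg a.1, a.2).
Definition entry_arc (e : entry V) : lit V * lit V := (neg e.1, e.2).

Lemma arc_clause_entry e : arc_clause (entry_arc e) = entry_clause e.
Proof. by rewrite /arc_clause /= negK. Qed.

Lemma arcs_implication u v :
  ((u, v) \in arcs (implication_graph F)) = ([set neg u; v] \in F).
Proof. by rewrite inE. Qed.

Lemma implication_graph_wf u v : (u, v) \in arcs (implication_graph F) ->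
  (u \in vertices (implication_graph F)) &&
  (v \in vertices (implication_graph F)).
Proof.
rewrite arcs_implication => uvF; rewrite !inE; apply/andP; split.
  apply/imsetP; exists (neg u) => //.
  by apply/bigcupP; exists [set neg u; v]; rewrite ?set21.
by apply/imsetP; exists v => //; apply/bigcupP; exists [set neg u; v]; rewrite ?set22.
Qed.

(** The linking condition turns the negated first literal and the successive second literals into a
    directed walk, which is then shortened. *)
Lemma walk_to_dpath L l w : l \notin negs L ->
    is_walk F w -> walk_from_to L l w ->
  exists p, [/\ is_dpath (implication_graph F) p, dpath_from_to (negs L) l p
    & {subset dpath_arcs p <= map entry_arc w}].
Proof.
case: w => [//|e w] lL /and3P[_ /allP wF ws] /= /andP[eL /eqP lastw].
(* Shortening with respect to [r], not the whole graph, keeps only arcs that come from [w]. *)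
pose r u v := (u, v) \in map entry_arc (e :: w).
have rp : path r (neg e.1) (map snd (e :: w)).
  rewrite path_dpath_arcs; apply/allP => a; suff -> :
    dpath_arcs (neg e.1 :: map snd (e :: w)) = map entry_arc (e :: w) by [].
  elim: w e ws {lL wF eL lastw r} => [|e' w IH] e //= /andP[/eqP ee' ws].
  by have := IH e' ws; rewrite /dpath_arcs /= /entry_arc ee' => ->.
have lastp : last (neg e.1) (map snd (e :: w)) = l by rewrite /= last_map.
case: (shortenP rp) lastp => p' rp' p'u _ lastp.
have sub : {subset dpath_arcs (neg e.1 :: p') <= map entry_arc (e :: w)}.
  by apply/allP; rewrite path_dpath_arcs in rp'.
have neL : neg e.1 \in negs L by rewrite imset_f.
exists (neg e.1 :: p'); split=> //; last by rewrite /= neL lastp eqxx.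
apply: (all_arcs_is_dpath implication_graph_wf) => //.
  by case: p' lastp {rp' p'u sub} => //= ll; rewrite -ll neL in lL.
by move=> a /sub /mapP[e' e'w ->]; rewrite arcs_implication negK; apply: wF.
Qed.

(** The clauses of an arc separator, at most as many as its arcs, separate [F]: a walk avoiding them
    would yield a directed path avoiding the arcs. *)
Lemma SepSize_le_ArcSepSize L l : l \notin negs L ->
  SepSize F L l <= ArcSepSize (implication_graph F) (negs L) l.
Proof.
move=> lL; rewrite /SepSize /ArcSepSize.
case: ex_minnP => n _ n_min.
case: ex_minnP => m /asboolP[S [SD nopath] <-] _.
apply: leq_trans (leq_imset_card arc_clause S).
apply: n_min; apply/asboolP; exists (arc_clause @: S) => //; split.
  by apply/subsetP => _ /imsetP[[u v] /(subsetP SD) uvD ->]; rewrite -arcs_implication.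
move=> [w /andP[/andP[/and3P[w0 /allP wF ws] _] wL]].
have wFw : is_walk F w.
  by apply/and3P; split=> //; apply/allP => e /wF; rewrite inE => /andP[].
have [p [/and4P[p1 pu pv ps] pL sub]] := walk_to_dpath lL wFw wL.
apply: nopath; exists p; rewrite pL andbT; apply/and4P; split=> //.
case: p ps sub {p1 pu pv pL} => //= x p; rewrite !path_dpath_arcs => /allP pD sub.
apply/allP => a ap /=; rewrite inE; apply/andP; split; last exact: pD.
have /mapP[e /wF eF aE] := sub a ap.
move: eF; rewrite inE => /andP[eS _]; apply: contra eS => aS.
by rewrite -arc_clause_entry -aE imset_f.
Qed.

Lemma satisfied_arc P u v : satisfying F P -> (u, v) \in arcs (implication_graph F) ->
  u \in P -> v \in P.
Proof.
move=> [nc _ sat]; rewrite arcs_implication => uvF /nc nuP.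
by have [l /set2P[->|->]] := sat _ uvF; rewrite ?(negPf nuP).
Qed.

(** The only other arc with the clause of [(u, v)] is its contrapositive [(neg v, neg u)], whose
    ends are false when [u] and [v] are true. *)
Lemma arc_clause_inj P : noncontradictory P ->
  {in setX P P &, injective arc_clause}.
Proof.
move=> nc [a b] [c d] /setXP[aP bP] /setXP[cP dP] /= /setP E.
have naP := nc _ aP; have ncP := nc _ cP.
have /set2P[bc|->] : b \in arc_clause (c, d) by rewrite -E set22.
  by rewrite -bc bP in ncP.
have /set2P[/= /(can_inj negK)->//|/= nad] : neg a \in arc_clause (c, d).
  by rewrite -E set21.
by rewrite nad dP in naP.
Qed.

Lemma dpath_satisfied L P l p : satisfying F P -> P :&: L = set0 ->
    is_dpath (implication_graph F) p -> dpath_from_to (negs L) l p ->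
  {subset dpath_arcs p <= setX P P}.
Proof.
move=> satP PL /and4P[_ _ pv ps]; case: p pv ps => //= x p /andP[xv _] ps.
case/andP=> /imsetP[l' l'L xE] _.
have xP : x \in P.
  have [_ varP _] := satP; move: xv; rewrite inE -varP => /imsetP[l1 l1P].
  case: l1 l1P => z b l1P; rewrite xE /neg /var /= => zE; subst z.
  (* [P] contains [l'] or its negation; [l'] itself would lie in [P :&: L]. *)
  suff -> : ~~ l'.2 = b by [].
  apply: contra_eq (eqxx (set0 : {set lit V})) => bl.
  have bE : l' = (l'.1, b) by case: (l') b bl {l1P} => z [] [].
  by have := in_set0 l'; rewrite -PL inE l'L {1}bE l1P.
elim: p x xP ps {xv xE} => //= z p IH x xP /andP[xz zp] a.
have zP := satisfied_arc satP xz xP.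
by rewrite inE => /predU1P[->|]; [rewrite in_setX xP zP | apply: IH].
Qed.

Lemma walk_clauses_arcs p :
  walk_clauses (map arc_entry (dpath_arcs p)) = map arc_clause (dpath_arcs p).
Proof. by rewrite /walk_clauses -map_comp. Qed.

(** Distinct vertices give distinct arcs, and these have distinct clauses because their ends are
    true under [P]. *)
Lemma dpath_to_path L P l p : satisfying F P -> P :&: L = set0 ->
    is_dpath (implication_graph F) p -> dpath_from_to (negs L) l p ->
  is_path F (map arc_entry (dpath_arcs p)) &&
  walk_from_to L l (map arc_entry (dpath_arcs p)).
Proof.
move=> satP PL pD pL; have pP := dpath_satisfied satP PL pD pL.
have /and4P[p1 pu _ ps] := pD; have [nc _ _] := satP.
rewrite /is_path walk_clauses_arcs map_inj_in_uniq ?dpath_arcs_uniq //; last first.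
  by move=> a b /pP aP /pP bP; apply: arc_clause_inj nc _ _ aP bP.
case: p p1 ps pL {pD pP pu} => [//|x [//|x' p]] _ ps /andP[xL lastp].
rewrite andbT; apply/andP; split; first (apply/and3P; split=> //).
- rewrite all_map; apply/allP => -[u v] uvp /=.
  move: ps; rewrite /= -/(path _ x (x' :: p)) path_dpath_arcs.
  by move=> /allP/(_ _ uvp) /=; rewrite inE.
- elim: p x x' {ps xL lastp} => [//|z p IH] x x'.
  by rewrite /= negK eqxx /=; apply: IH.
have /imsetP[l' l'L xE] := xL.
rewrite /= xE negK l'L /= -(eqP lastp) /=; apply/eqP.
elim: p (neg l') x' {ps xL xE lastp} => //= z p IH u x'.
Qed.

(** Injectivity of [arc_clause] on true literals also works across paths: a shared clause would be a
    shared arc. *)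
Lemma MaxArcPaths_le_MaxPaths L P l : satisfying F P -> P :&: L = set0 ->
  MaxArcPaths (implication_graph F) (negs L) l <= MaxPaths F L l.
Proof.
move=> satP PL; rewrite /MaxArcPaths /MaxPaths.
case: ex_maxnP => n /asboolP[ps [<- psD dps]] _.
case: ex_maxnP => m _ m_max; apply: m_max; apply/asboolP.
exists [seq map arc_entry (dpath_arcs p) | p <- ps]; split.
- by rewrite size_map.
- by move=> _ /mapP[p /psD/andP[pD pL] ->]; apply: (dpath_to_path satP PL pD pL).
move: dps; rewrite /pairwise_disjoint !pairwise_map.
have [nc _ _] := satP.
apply: (@sub_in_pairwise _ (fun p => p \in ps)); last exact/allP.
move=> p q /psD/andP[pD pL] /psD/andP[qD qL]; apply: contra.
rewrite !walk_clauses_arcs => /hasP[_ /mapP[a aq ->] /mapP[b bp ab]].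
apply/hasP; exists a => //=.
rewrite (arc_clause_inj nc _ _ ab) //.
  exact: (dpath_satisfied satP PL qD qL).
exact: (dpath_satisfied satP PL pD pL).
Qed.

End TwoCNF.

Theorem theorem2 (V : finType) (F : {set {set lit V}}) (L : {set lit V})
    (ly : lit V)
    (F_2cnf : is_2cnf F)
    (F_sat : SWRT F (negs L))
    (ly_L : var ly \notin lit_vars L) :
  let D := implication_graph F in
  [/\ MaxPaths F L ly = MaxArcPaths D (negs L) ly,
      SepSize F L ly = ArcSepSize D (negs L) ly
    & MaxPaths F L ly = SepSize F L ly].
Proof.
move=> D; have [P satP PnL] := F_sat.
have PL : P :&: L = set0.
  move: PnL; rewrite /negs -imset_comp (eq_imset (g := id)) ?imset_id //.
  exact: negK.
have lyL : ly \notin negs L.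
  by apply: contra ly_L => /imsetP[l lL ->]; apply/imsetP; exists l.
have := ArcSepSize_le_MaxArcPaths (@implication_graph_wf V F) lyL.
have := MaxArcPaths_le_MaxPaths ly satP PL.
have := MaxPaths_le_SepSize F L ly.
have := SepSize_le_ArcSepSize F lyL.
by rewrite -/D => *; split; lia.
Qed.
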